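(* Let $G$ be a finite group with center $Z(G)$ such that $G/Z(G)$ is isomorphic to the dihedral group $D_{2m}$ of order $2m$, where $m\ge 3$, and let $\Gamma_G$ be its non-commuting graph. Then: (a) $E(\Gamma_G)<LE^+(\Gamma_G)<LE(\Gamma_G)$. (b) $\Gamma_G$ is neither hypoenergetic nor hyperenergetic. (c) If $m=3$ and $|Z(G)|=1$, then $\Gamma_G$ is L-hyperenergetic but not Q-hyperenergetic. If $m\in\{3,4\}$ and $|Z(G)|\ne 1$, or if $m\ge 5$ and $|Z(G)|\ge 1$, then $\Gamma_G$ is both Q-hyperenergetic and L-hyperenergetic.
   Context: For a finite non-abelian group $G$ with center $Z(G)$, the non-commuting graph $\Gamma_G$ is the simple undirected graph with vertex set $G\setminus Z(G)$ in which $x,y$ are adjacent iff $xy\ne yx$. For a finite simple graph $\mathcal G$ with vertex set $v(\mathcal G)$, edge set $e(\mathcal G)$, adjacency matrix $A(\mathcal G)$ and diagonal degree matrix $D(\mathcal G)$, put $L(\mathcal G)=D(\mathcal G)-A(\mathcal G)$ (Laplacian) and $Q(\mathcal G)=D(\mathcal G)+A(\mathcal G)$ (signless Laplacian). With sums over eigenvalues counted with multiplicity, define $E(\mathcal G)=\sum_{\lambda}|\lambda|$ ($\lambda$ eigenvalues of $A(\mathcal G)$), $LE(\mathcal G)=\sum_{\beta}\left|\beta-\frac{2|e(\mathcal G)|}{|v(\mathcal G)|}\right|$ ($\beta$ eigenvalues of $L(\mathcal G)$), $LE^+(\mathcal G)=\sum_{\gamma}\left|\gamma-\frac{2|e(\mathcal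 G)|}{|v(\mathcal G)|}\right|$ ($\gamma$ eigenvalues of $Q(\mathcal G)$). With $K_n$ the complete graph on $n$ vertices, $\mathcal G$ is called hyperenergetic if $E(\mathcal G)>E(K_{|v(\mathcal G)|})$, hypoenergetic if $E(\mathcal G)<|v(\mathcal G)|$, L-hyperenergetic if $LE(\mathcal G)>LE(K_{|v(\mathcal G)|})$, and Q-hyperenergetic if $LE^+(\mathcal G)>LE^+(K_{|v(\mathcal G)|})$. *)

(* Defs.v *)
From HB Require Import structures.
From mathcomp Require Import all_boot all_order all_algebra.
From mathcomp Require Import all_fingroup all_solvable all_field.

Set Implicit Arguments.
Unset Strict Implicit.
Unset Printing Implicit Defensive.

Import Order.TTheory GRing.Theory Num.Theory.
Local Open Scope ring_scope.

Record sgraph := SGraph {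
  vertex :> finType;
  adj : rel vertex;
  adj_sym : symmetric adj;
  adj_irr : irreflexive adj }.

Section Graph.
Variable g : sgraph.

Definition edges : {set {set g}} :=
  [set [set p.1; p.2] | p : g * g & adj p.1 p.2].

Definition deg (x : g) : nat := #|[set y | adj x y]|.

Definition adjacency_mx : 'M[algC]_#|g| :=
  \matrix_(i, j) (adj (enum_val i) (enum_val j))%:R.

Definition degree_mx : 'M[algC]_#|g| :=
  diag_mx (\row_i (deg (enum_val i))%:R).

Definition laplacian_mx : 'M[algC]_#|g| := degree_mx - adjacency_mx.

Definition signless_laplacian_mx : 'M[algC]_#|g| := degree_mx + adjacency_mx.

End Graph.

(* The eigenvalues with (algebraic) multiplicity: the roots of the            *)
(* characteristic polynomial. Since algC is algebraically closed and contains *)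
(* the entries, no eigenvalue is lost.                                        *)
Definition spectrum n (A : 'M[algC]_n) : seq algC :=
  sval (closed_field_poly_normal (char_poly A)).

(* All the energies below are sums of norms, hence real elements of algC, on  *)
(* which the partial order of algC is the usual total order.                  *)
Definition energy (g : sgraph) : algC :=
  \sum_(l <- spectrum (adjacency_mx g)) `|l|.

Definition average_degree (g : sgraph) : algC :=
  (2 * #|edges g|)%:R / #|g|%:R.

Definition laplacian_energy (g : sgraph) : algC :=
  \sum_(b <- spectrum (laplacian_mx g)) `|b - average_degree g|.

Definition signless_laplacian_energy (g : sgraph) : algC :=
  \sum_(c <- spectrum (signless_laplacian_mx g)) `|c - average_degree g|.

Fact complete_sym n : symmetric [rel i j : 'I_n | i != j].
Proof. by move=> i j; rewrite /= eq_sym. Qed.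

Fact complete_irr n : irreflexive [rel i j : 'I_n | i != j].
Proof. by move=> i; rewrite /= eqxx. Qed.

Definition complete_graph n : sgraph :=
  SGraph (@complete_sym n) (@complete_irr n).

Definition hyperenergetic (g : sgraph) : Prop :=
  energy g > energy (complete_graph #|g|).

Definition hypoenergetic (g : sgraph) : Prop :=
  energy g < #|g|%:R.

Definition L_hyperenergetic (g : sgraph) : Prop :=
  laplacian_energy g > laplacian_energy (complete_graph #|g|).

Definition Q_hyperenergetic (g : sgraph) : Prop :=
  signless_laplacian_energy g
    > signless_laplacian_energy (complete_graph #|g|).

Section NonCommutingGraph.
Variables (gT : finGroupType) (G : {group gT}).
Local Open Scope group_scope.

Definition noncentral : finType := {x : gT | x \in G :\: 'Z(G)}.

Definition noncommuting : rel noncentral :=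
  [rel x y | val x * val y != val y * val x].

Fact noncommuting_sym : symmetric noncommuting.
Proof. by move=> x y; rewrite /noncommuting /= eq_sym. Qed.

Fact noncommuting_irr : irreflexive noncommuting.
Proof. by move=> x; rewrite /noncommuting /= eqxx. Qed.

Definition noncommuting_graph : sgraph :=
  SGraph noncommuting_sym noncommuting_irr.

End NonCommutingGraph.

(* Main.v *)
(* If A is the preimage in G of the rotation subgroup, then A is abelian of
   index 2, and two non-central elements commute exactly when both lie in A or
   both lie in the same coset of Z(G). Hence, with n = |Z(G)|, the graph is
   complete multipartite with one part of size (m - 1) n and m parts of size n.
   For such graphs the matrix diag(d) + e A, with d constant on the parts, is a
   block-constant matrix plus a matrix of rank one, so two applications of
   det(1 + B C) = det(1 + C B) give its characteristic polynomial; all its roots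
   are explicit up to a quadratic factor. Everything then reduces to inequalities
   involving sqrt((m - 1)(5 m - 1)) and sqrt(8 (m - 1)^2 + 1). *)

Require Import Defs.
From HB Require Import structures.
From mathcomp Require Import all_boot all_order all_algebra.
From mathcomp Require Import all_fingroup all_solvable all_field.
From mathcomp Require Import ring lra zify.

Set Implicit Arguments.
Unset Strict Implicit.
Unset Printing Implicit Defensive.

Import Order.TTheory GRing.Theory Num.Theory.

(** * Determinants of block-constant matrices and their rank-one perturbations *)

Section Determinants.
Local Open Scope ring_scope.

(** Sylvester's identity: one block matrix factors into block triangular matrices in two ways, and
    the two products of determinants agree. *)
Lemma det_1D_mulmxC (R : comNzRingType) m n (A : 'M[R]_(m, n)) (B : 'M_(n, m)) :
  \det (1%:M + A *m B) = \det (1%:M + B *m A).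
Proof.
have dl : block_mx 1%:M (- A) B 1%:M
    = block_mx 1%:M 0 B 1%:M *m block_mx 1%:M (- A) 0 (1%:M + B *m A).
  rewrite mulmx_block !(mul1mx, mul0mx, mulmx1, addr0) mulmxN.
  by rewrite addrCA addNr addr0.
have dr : block_mx 1%:M (- A) B 1%:M
    = block_mx 1%:M (- A) 0 1%:M *m block_mx (1%:M + A *m B) 0 B 1%:M.
  rewrite mulmx_block !(mul1mx, mul0mx, mulmx0, mulmx1, add0r) mulNmx.
  by rewrite addrK.
have := congr1 determinant dl; rewrite dr !det_mulmx !det_ublock !det_lblock.
by rewrite !det1 !mul1r mulr1.
Qed.

Section BlockConstant.
Variables (F : fieldType) (N : nat) (I : finType) (p : 'I_N -> I).
Variables (a : I -> F) (e : F).
Let s i := #|[set v | p v == i]|%:R : F.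
Hypotheses (a_neq0 : forall i, a i != 0) (as_neq0 : forall i, a i + e * s i != 0).

Lemma sum_block i (c : F) : \sum_v (if p v == i then c else 0) = s i * c.
Proof. by rewrite -big_mkcond sumr_const mulr_natl /s cardsE. Qed.

Let E1 : 'M[F]_N := \matrix_(v, w) (a (p v) *+ (v == w) + e *+ (p v == p w)).

(** After the diagonal is factored out, the rest is [1 + U W] with [U W] passing through the index
    set [I]. Swapping the factors leaves an [I] by [I] matrix, which is diagonal because the blocks
    are disjoint. An empty block contributes the factor 1. *)
Lemma det_block_diag :
  \det E1 = \prod_v a (p v) * \prod_i (1 + e * s i / a i).
Proof.
pose U : 'M[F]_(N, #|I|) := \matrix_(v, i)
  (if p v == enum_val i then e / a (enum_val i) else 0).
pose W : 'M[F]_(#|I|, N) := \matrix_(i, w) (p w == enum_val i)%:R.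
have -> : E1 = diag_mx (\row_v a (p v)) *m (1%:M + U *m W).
  apply/matrixP=> v w; rewrite mul_diag_mx !mxE mulrDr mulr_natr; congr (_ + _).
  rewrite (bigD1 (enum_rank (p v))) //= !mxE enum_rankK eqxx big1 => [|i i_pv].
    by rewrite addr0 eq_sym; case: eqP => _; rewrite ?mulr1 ?mulr0 // mulrC divfK.
  rewrite !mxE; case: eqP => [pvi|_]; last by rewrite mul0r.
  by rewrite pvi enum_valK eqxx in i_pv.
rewrite det_mulmx det_1D_mulmxC det_diag; congr (_ * _).
  by apply: eq_bigr => v _; rewrite mxE.
have -> : 1%:M + W *m U = diag_mx (\row_i (1 + e * s (enum_val i) / a (enum_val i))).
  apply/matrixP=> i j; rewrite !mxE.
  have [<-|ij] := eqVneq i j.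
    rewrite mulr1n; congr (_ + _); rewrite mulrAC mulrC -sum_block.
    by apply: eq_bigr => v _; rewrite !mxE; case: eqP; rewrite ?mul1r ?mul0r.
  rewrite add0r big1 // => v _; rewrite !mxE.
  case: eqP => [->|_]; last by rewrite mul0r.
  by rewrite (inj_eq enum_val_inj) (negPf ij) mulr0.
rewrite det_diag [RHS](reindex (@enum_val I predT)) /=; last first.
  exact/onW_bij/enum_val_bij.
by apply: eq_bigr => i _; rewrite mxE.
Qed.

(** Subtracting [e] off the blocks is adding [e] on the blocks and subtracting [e] everywhere, so
    the matrix is [E1] minus a multiple of the all-ones matrix, which has rank one. *)
Lemma det_multipartite :
  \det (\matrix_(v, w) (a (p v) *+ (v == w) - e *+ (p v != p w)))
  = \prod_i (a i ^+ #|[set v | p v == i]| * (1 + e * s i / a i))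
    * (1 - e * \sum_i s i / (a i + e * s i)).
Proof.
(* [z] solves [E1 z = -e 1]: on vectors constant on the blocks, [E1] multiplies the value on block
   [i] by [a i + e * s i]. *)
pose z : 'cV[F]_N := \col_v (- e / (a (p v) + e * s (p v))).
have -> : \matrix_(v, w) (a (p v) *+ (v == w) - e *+ (p v != p w))
    = E1 *m (1%:M + z *m (const_mx 1 : 'rV_N)).
  rewrite mulmxDr mulmx1 mulmxA.
  have -> : E1 *m z = const_mx (- e).
    apply/matrixP=> v j; rewrite !mxE.
    rewrite (eq_bigr (fun w => (if w == v then a (p v) * z v 0 else 0)
      + (if p w == p v then e * z v 0 else 0))) => [|w _].
      rewrite big_split sum_block -big_mkcond big_pred1_eq /= !mxE.
      by rewrite mulrA -mulrDl mulrC [s _ * e]mulrC divfK.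
    rewrite !mxE mulrDl; congr (_ + _).
      by rewrite eq_sym; case: eqP => [->|_]; rewrite ?mulr1n ?mul0r.
    by rewrite eq_sym; case: eqP => [->|_]; rewrite ?mulr1n ?mul0r.
  apply/matrixP=> v w; rewrite !mxE big_ord1 !mxE mulr1 -addrA; congr (_ + _).
  by case: eqP => _ /=; rewrite ?mulr1n ?mulr0n ?subrr ?oppr0 ?add0r.
rewrite det_mulmx det_1D_mulmxC det_block_diag big_split /=.
congr (_ * _ * _).
  rewrite (partition_big p predT) //=; apply: eq_bigr => i _.
  rewrite (eq_bigr (fun=> a i)) => [|v /eqP -> //].
  by rewrite prodr_const cardsE.
rewrite [_ + _]mx11_scalar det_scalar1 !mxE /= mulr1n; congr (_ + _).
rewrite -mulNr mulr_sumr.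
rewrite (partition_big p predT) //=; apply: eq_bigr => i _.
rewrite (eq_bigr (fun=> - e / (a i + e * s i))) => [|v /eqP vi].
  by rewrite sumr_const mulrCA mulr_natl /s cardsE.
by rewrite !mxE vi mul1r.
Qed.

End BlockConstant.

End Determinants.

(** * Spectra of complete multipartite graphs *)

Section Spectrum.
Local Open Scope ring_scope.

(** The product [(p - q) * b] vanishes everywhere, in particular at more natural numbers than its
    degree allows. *)
Lemma poly_eq_off_roots (R : numDomainType) (b p q : {poly R}) :
  b != 0 -> (forall x, b.[x] != 0 -> p.[x] = q.[x]) -> p = q.
Proof.
move=> b_neq0 eq_pq; apply/eqP; rewrite -subr_eq0; apply: contraT => pq_neq0.
have r_neq0 : (p - q) * b != 0 by rewrite mulf_neq0.
pose rs : seq R := [seq i%:R | i <- iota 0 (size ((p - q) * b)%R)].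
suff /(max_poly_roots r_neq0) : all (root ((p - q) * b)) rs.
  by rewrite map_inj_uniq ?iota_uniq ?size_map ?size_iota ?ltnn => [->|i j /eqP];
    rewrite ?eqr_nat => // /eqP.
apply/allP => x _; rewrite rootE !hornerE.
by have [->|/eq_pq ->] := eqVneq b.[x] 0; rewrite ?mulr0 ?subrr ?mul0r.
Qed.

Lemma spectrum_prod n (M : 'M[algC]_n) s :
  char_poly M = \prod_(z <- s) ('X - z%:P) -> perm_eq (spectrum M) s.
Proof.
move=> def_s; apply: prod_XsubC_eq; rewrite -def_s /spectrum.
case: closed_field_poly_normal => r /= def_r.
by rewrite [RHS]def_r (monicP (char_poly_monic M)) scale1r.
Qed.

Lemma horner_char_poly (F : comNzRingType) n (M : 'M[F]_n) x :
  (char_poly M).[x] = \det (x%:M - M).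
Proof.
rewrite /char_poly -[_.[x]]/(horner_eval x _) -det_map_mx; congr (\det _).
by apply/matrixP=> i j; rewrite !mxE rmorphB rmorphMn /= /horner_eval !hornerE.
Qed.

(* One part of size a, indexed by i0, and m parts of size n, indexed by S; the
   remaining elements of I index nothing. *)
Definition complete_multipartite (g : sgraph) (a m n : nat) : Prop :=
  exists (I : finType) (p : g -> I) (i0 : I) (S : {set I}),
  [/\ forall x y, adj x y = (p x != p y),
      i0 \notin S /\ #|S| = m,
      #|[set x | p x == i0]| = a,
      {in S, forall i, #|[set x | p x == i]| = n}
    & forall x, p x \in i0 |: S].

Section Multipartite.
Variables (g : sgraph) (I : finType) (p : g -> I) (i0 : I) (S : {set I}).
Variables (a m n : nat).
Hypotheses (adjE : forall x y, adj x y = (p x != p y)) (i0S : i0 \notin S).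
Hypotheses (cardS : #|S| = m) (card_i0 : #|[set x | p x == i0]| = a).
Hypothesis card_in : {in S, forall i, #|[set x | p x == i]| = n}.
Hypothesis p_in : forall x, p x \in i0 |: S.

Lemma card_block i :
  #|[set x | p x == i]| = if i == i0 then a else if i \in S then n else 0%N.
Proof.
case: eqP => [->//|/eqP i_neq]; case: ifP => [/card_in //|iNS].
apply: eq_card0 => x; rewrite !inE; apply: contraTF (p_in x) => /eqP ->.
by rewrite !inE negb_or i_neq iNS.
Qed.

Lemma big_parts (R : Type) (idx : R) (op : Monoid.com_law idx) (F : I -> R) :
  (forall i, i != i0 -> i \notin S -> F i = idx) ->
  \big[op/idx]_i F i = op (F i0) (\big[op/idx]_(i in S) F i).
Proof.
move=> Fidx; rewrite (bigD1 i0) //=; congr (op _ _).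
rewrite (bigID (mem S)) /= [X in op _ X]big1 => [|i /andP[]]; last exact: Fidx.
rewrite Monoid.mulm1; apply: eq_bigl => i.
by have [->|] := eqVneq i i0; rewrite ?(negPf i0S).
Qed.

Lemma card_multipartite : #|g| = (a + m * n)%N.
Proof.
rewrite -sum1_card (partition_big p predT) //= (@big_parts _ _ addn).
  rewrite sum1dep_card card_i0 (eq_bigr (fun=> n)) => [|i iS].
    by rewrite sum_nat_const cardS.
  by rewrite sum1dep_card card_in.
by move=> i i_neq iNS; rewrite sum1dep_card card_block (negPf i_neq) (negPf iNS).
Qed.

Lemma degE x : (deg x = #|g| - #|[set y | p y == p x]|)%N.
Proof.
rewrite -(cardsC [set y | p y == p x]) addKn; apply: eq_card => y.
by rewrite !inE adjE eq_sym.
Qed.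

Lemma deg_multipartite x : (0 < m)%N ->
  deg x = if p x == i0 then (m * n)%N else (a + m.-1 * n)%N.
Proof.
move=> m_gt0; rewrite degE card_multipartite card_block.
have -> : (m * n = n + m.-1 * n)%N by rewrite -mulSn prednK.
move: (m.-1 * n)%N => k.
have := p_in x; rewrite !inE; case: (p x == i0) => /= [_|-> /=]; lia.
Qed.

(** Free [d0], [d1], [e] cover the adjacency, Laplacian and signless Laplacian matrices at once. The
    first two families of roots belong to vectors of sum zero inside one part, the third to
    differences between parts of size [n]. The last two roots are those of the 2 by 2 quotient
    matrix, given by its trace and determinant so that no square root is needed here. *)
Lemma char_poly_multipartite (d0 d1 e r1 r2 : algC) :
  (0 < a)%N -> (0 < m)%N -> (0 < n)%N ->
  r1 + r2 = d0 + d1 - e * n%:R + e * (m * n)%:R ->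
  r1 * r2 = d0 * d1 - e * n%:R * d0 + e * (m * n)%:R * d0
            - e ^+ 2 * (m * n * a)%:R ->
  char_poly (diag_mx (\row_j (if p (enum_val j) == i0 then d0 else d1))
             + e *: adjacency_mx g)
  = \prod_(z <- nseq a.-1 d0 ++ nseq (m * n.-1) d1
             ++ nseq m.-1 (d1 - e * n%:R) ++ [:: r1; r2]) ('X - z%:P).
Proof.
move=> a_gt0 m_gt0 n_gt0 r_sum r_prod.
pose b : {poly algC} := ('X - d0%:P) * ('X - d1%:P)
  * ('X - (d0 - e * a%:R)%:P) * ('X - (d1 - e * n%:R)%:P).
(* Off the roots of b all the divisions in det_multipartite are legitimate. *)
apply: (@poly_eq_off_roots _ b); first by rewrite !mulf_neq0 ?polyXsubC_eq0.
move=> x; rewrite !hornerE !mulf_eq0 !negb_or !opprB !addrA => /andP[/andP[/andP[]]].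
move=> A0 B0 u0 w0; rewrite horner_char_poly.
pose q (j : 'I_#|g|) := p (enum_val j).
pose dl i := x - (if i == i0 then d0 else d1).
have card_q i : #|[set v | q v == i]| = #|[set y | p y == i]|.
  rewrite -(on_card_preimset (onW_bij _ (enum_val_bij g))).
  by apply: eq_card => v; rewrite !inE.
have -> : x%:M - (diag_mx (\row_j (if p (enum_val j) == i0 then d0 else d1))
             + e *: adjacency_mx g)
   = \matrix_(v, w) (dl (q v) *+ (v == w) - e *+ (q v != q w)).
  apply/matrixP=> v w; rewrite !mxE opprD addrA -mulrnBl adjE.
  by rewrite mulr_natr.
rewrite det_multipartite => [|i|i]; first last.
- rewrite card_q card_block /dl.
  have [_|_] := eqVneq i i0; first by rewrite addrAC.
  by case: ifP => _; [rewrite addrAC | rewrite mulr0 addr0].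
- by rewrite /dl; case: ifP.
pose f i := #|[set y | p y == i]|.
rewrite (eq_bigr (fun i => dl i ^+ f i * (1 + e * (f i)%:R / dl i))); last first.
  by move=> i _; rewrite card_q.
rewrite [\sum_i _](eq_bigr (fun i => (f i)%:R / (dl i + e * (f i)%:R))); last first.
  by move=> i _; rewrite card_q.
have dl1 : {in S, forall i, dl i = x - d1}.
  by move=> i iS; rewrite /dl; case: eqP iS => // ->; rewrite (negPf i0S).
have f0 i : i != i0 -> i \notin S -> f i = 0%N.
  by rewrite /f card_block => /negPf -> /negPf ->.
rewrite !big_parts /=; first last.
- by move=> i i_neq iNS; rewrite f0 // mulr0 mul0r addr0 mulr1.
- by move=> i i_neq iNS; rewrite f0 // mul0r.
rewrite [\prod_(_ in _) _](eq_bigr (fun=> (x - d1) ^+ n * (1 + e * n%:R / (x - d1))));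
  last by move=> i iS; rewrite /f card_in // dl1.
rewrite [\sum_(_ in _) _](eq_bigr (fun=> n%:R / (x - d1 + e * n%:R)));
  last by move=> i iS; rewrite /f card_in // dl1.
rewrite prodr_const sumr_const cardS /f card_i0 /dl eqxx.
rewrite !big_cat /= !big_nseq !iter_mulr_1 !big_cons big_nil mulr1.
rewrite !hornerE /=.
(* One of the [k] equal factors clears the denominator. *)
have absorb c k : x - c != 0 -> (0 < k)%N ->
    (x - c) ^+ k * (1 + e * k%:R / (x - c)) = (x - c) ^+ k.-1 * (x + e * k%:R - c).
  by move=> c0 k_gt0; rewrite -{1}(prednK k_gt0) exprSr -mulrA; congr (_ * _); field.
(* The rank-one factor has two denominators. They are cleared by the linear factor of the part [i0]
   and by one of the [m] equal factors of the other parts, which leaves multiplicity [m.-1] for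
   [d1 - e * n%:R]. *)
have quadratic : (x + e * a%:R - d0) * (x + e * n%:R - d1)
    * (1 - e * (a%:R / (x - d0 + e * a%:R) + n%:R / (x - d1 + e * n%:R) *+ m))
    = (x - r1) * (x - r2).
  have -> : (x - r1) * (x - r2) = x ^+ 2 - (r1 + r2) * x + r1 * r2 by ring.
  rewrite r_sum r_prod !natrM -[_ *+ m]mulr_natr ![_ - _ + e * _]addrAC.
  by field; rewrite u0 w0.
rewrite !absorb // exprMn -exprM [(n.-1 * m)%N]mulnC -{2}(prednK m_gt0) exprSr.
rewrite -[RHS]mulrA -quadratic opprB [x + (_ - d1)]addrA.
move: (_ ^+ a.-1) (_ ^+ (m * _)) (_ ^+ m.-1) (1 - _) => A B C D; ring.
Qed.

(** All the data are real, so the sum is expressed in the ordered field [algR], where inequalities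
    can be settled by real arithmetic. *)
Lemma sum_spectrum_multipartite (d0 d1 e r1 r2 c : algR) (M : 'M[algC]_#|g|) :
  (0 < a)%N -> (0 < m)%N -> (0 < n)%N ->
  r1 + r2 = d0 + d1 - e * n%:R + e * (m * n)%:R ->
  r1 * r2 = d0 * d1 - e * n%:R * d0 + e * (m * n)%:R * d0
            - e ^+ 2 * (m * n * a)%:R ->
  M = diag_mx (\row_j (algRval (if p (enum_val j) == i0 then d0 else d1)))
      + algRval e *: adjacency_mx g ->
  \sum_(z <- spectrum M) `|z - algRval c|
  = algRval (a.-1%:R * `|d0 - c| + (m * n.-1)%:R * `|d1 - c|
             + m.-1%:R * `|d1 - e * n%:R - c| + `|r1 - c| + `|r2 - c|).
Proof.
move=> a_gt0 m_gt0 n_gt0 r_sum r_prod ->.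
have -> : \row_(j < #|g|) algRval (if p (enum_val j) == i0 then d0 else d1)
    = \row_j (if p (enum_val j) == i0 then algRval d0 else algRval d1).
  by apply/rowP=> j; rewrite !mxE; case: ifP.
rewrite (perm_big _ (spectrum_prod (@char_poly_multipartite (algRval d0)
  (algRval d1) (algRval e) (algRval r1) (algRval r2) a_gt0 m_gt0 n_gt0 _ _))).
- have -> : algRval d1 - algRval e * n%:R = algRval (d1 - e * n%:R).
    by rewrite rmorphB rmorphM rmorph_nat.
  move: (d1 - e * n%:R) => t.
  rewrite !big_cat !big_nseq !iter_addr_0 !big_cons big_nil [LHS]/= addr0.
  by rewrite !mulr_natl !rmorphD !rmorphMn !addrA.
- have /(congr1 algRval) := r_sum.
  by rewrite !(rmorphB, rmorphD, rmorphM algRval, rmorph_nat).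
- have /(congr1 algRval) := r_prod.
  by rewrite !(rmorphB, rmorphD, rmorphM algRval, rmorph_nat, rmorphXn).
Qed.

End Multipartite.

(** Ordered adjacent pairs are counted twice: by first coordinate, which gives degrees, and by
    underlying edge. *)
Lemma handshake (g : sgraph) : (2 * #|edges g| = \sum_x @deg g x)%N.
Proof.
pose h (u : g * g) := [set u.1; u.2].
have -> : (\sum_x @deg g x = \sum_(u : g * g | adj u.1 u.2) 1)%N.
  rewrite -(pair_big_dep xpredT (fun x y => adj x y) (fun _ _ => 1%N)) /=.
  by apply: eq_bigr => x _; rewrite sum1dep_card.
rewrite (partition_big_imset h) /=.
rewrite (eq_bigr (fun=> 2%N)) => [|E /imsetP[[x y]]]; last rewrite unfold_in /= => xy ->.
  rewrite sum_nat_const mulnC; congr (_ * _)%N; apply: eq_card => E.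
  by apply/imsetP/imsetP=> -[u]; rewrite ?inE => ? ->; exists u; rewrite ?inE.
rewrite sum1dep_card.
have x_neq_y : x != y by apply: contraTneq xy => ->; rewrite adj_irr.
(* An edge comes from its two orderings, which are distinct by irreflexivity. *)
have -> : [set u : g * g | adj u.1 u.2 && (h u == h (x, y))] = [set (x, y); (y, x)].
  apply/setP=> -[u v]; rewrite !inE /h /= !xpair_eqE.
  apply/andP/orP => [[uv /eqP/setP eq_uv]|[] /andP[/eqP-> /eqP->]]; first last.
  - by rewrite adj_sym xy setUC.
  - by rewrite xy.
  have u_neq_v : u != v by apply: contraTneq uv => ->; rewrite adj_irr.
  have := eq_uv u; have := eq_uv v; rewrite !inE !eqxx ?orbT.
  case: (eqVneq v x) => [vx|_] /=; case: (eqVneq u x) => [ux|_] //=.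
  - by rewrite vx ux eqxx in u_neq_v.
  - by move=> _ /esym /= ->; right.
  - by move=> /esym -> _; left.
  by move=> /esym/eqP vy /esym/eqP uy; rewrite uy vy eqxx in u_neq_v.
by rewrite cards2 xpair_eqE negb_and x_neq_y.
Qed.

End Spectrum.

(** * The three energies of a complete multipartite graph *)

Section Energies.
Local Open Scope ring_scope.
Variables (g : sgraph) (a m n : nat).
Hypotheses (gP : complete_multipartite g a m n).
Hypotheses (a_gt0 : (0 < a)%N) (m_gt0 : (0 < m)%N) (n_gt0 : (0 < n)%N).

(** The numerator is the degree sum: [a] vertices of degree [m * n] and [m * n] vertices of degree
    [a + m.-1 * n]. *)
Definition multipartite_degree : algR :=
  (m * n * (2 * a + m.-1 * n))%:R / (a + m * n)%:R.

Lemma card_complete_multipartite : #|g| = (a + m * n)%N.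
Proof.
case: gP => I [p [i0 [S [_ [i0S cardS] c0 cS pS]]]].
exact: card_multipartite i0S cardS c0 cS pS.
Qed.

Lemma average_degree_multipartite : average_degree g = algRval multipartite_degree.
Proof.
rewrite /average_degree /multipartite_degree rmorphM fmorphV !rmorph_nat.
rewrite card_complete_multipartite handshake; congr (_%:R / _).
case: gP => I [p [i0 [S [adjE [i0S cardS] c0 cS pS]]]].
rewrite (eq_bigr _ (fun x _ => deg_multipartite adjE i0S cardS c0 cS pS x m_gt0)).
rewrite (bigID (fun x => p x == i0)) /=.
rewrite (eq_bigr (fun=> m * n)%N) => [|x ->//].
rewrite [X in (_ + X)%N](eq_bigr (fun=> a + m.-1 * n)%N) => [|x /negPf->//].
rewrite !sum_nat_const -(cardsE (fun x => p x == i0)).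
rewrite -(cardsE (fun x => p x != i0)) c0.
have := cardsC [set x | p x == i0].
rewrite c0 card_complete_multipartite => /eqP; rewrite eqn_add2l => /eqP cardC0.
rewrite (_ : [set x | p x != i0] = ~: [set x | p x == i0]) ?cardC0; last first.
  by apply/setP=> x; rewrite !inE.
by rewrite [X in (X + _)%N]mulnC -mulnDr addnA addnn -mul2n.
Qed.

Lemma energy_multipartite (r1 r2 : algR) :
  r1 + r2 = (m.-1 * n)%:R -> r1 * r2 = - (m * n * a)%:R ->
  energy g = algRval ((m.-1 * n)%:R + `|r1| + `|r2|).
Proof.
case: gP => I [p [i0 [S [adjE [i0S cardS] c0 cS pS]]]] r_sum r_prod.
have m1E : m%:R = m.-1%:R + 1 :> algR by rewrite -{1}(prednK m_gt0) -natr1.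
rewrite /energy.
under eq_bigr do rewrite -[X in `|X|]subr0 -(rmorph0 algRval).
rewrite (sum_spectrum_multipartite adjE i0S cardS c0 cS pS (d0 := 0) (d1 := 0)
  (e := 1) (r1 := r1) (r2 := r2)) //.
- by rewrite !subr0 normr0 !mulr0 !add0r mul1r normrN normr_nat -natrM.
- by rewrite r_sum !natrM m1E; ring.
- by rewrite r_prod; ring.
have -> : \row_(j < #|g|) algRval (if p (enum_val j) == i0 then 0 else 0) = 0.
  by apply/rowP=> j; rewrite !mxE if_same rmorph0.
by rewrite raddf0 add0r rmorph1 scale1r.
Qed.

Let dl0 : algR := (m * n)%:R.
Let dl1 : algR := (a + m.-1 * n)%:R.
Let c := multipartite_degree.

(** With [e = -1] the quotient roots are 0, which gives the summand [c], and the number of vertices.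
    The latter equals [dl1 + n], so it joins the [m.-1] roots of that family and has multiplicity
    [m]. *)
Lemma laplacian_energy_multipartite :
  laplacian_energy g = algRval (a.-1%:R * `|dl0 - c| + (m * n.-1)%:R * `|dl1 - c|
     + m%:R * `|(a + m * n)%:R - c| + c).
Proof.
have m1E : m%:R = m.-1%:R + 1 :> algR by rewrite -{1}(prednK m_gt0) -natr1.
rewrite /laplacian_energy average_degree_multipartite.
case: gP => I [p [i0 [S [adjE [i0S cardS] c0 cS pS]]]].
rewrite (sum_spectrum_multipartite adjE i0S cardS c0 cS pS (d0 := dl0)
  (d1 := dl1) (e := -1) (r1 := 0) (r2 := (a + m * n)%:R)) //.
- congr algRval; rewrite sub0r normrN.
  rewrite [`|multipartite_degree|]ger0_norm; last by rewrite divr_ge0 ?ler0n.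
  rewrite (_ : dl1 - -1 * n%:R = (a + m * n)%:R); last first.
    by rewrite /dl1 !natrD !natrM m1E; ring.
  by rewrite m1E /c; ring.
- by rewrite /dl0 /dl1 !natrD !natrM m1E; ring.
- by rewrite /dl0 /dl1 !natrD !natrM m1E; ring.
rewrite /laplacian_mx rmorphN1 scaleN1r; congr (diag_mx _ - _).
apply/rowP=> j; rewrite !mxE.
rewrite (deg_multipartite adjE i0S cardS c0 cS pS _ m_gt0).
by case: ifP; rewrite rmorph_nat.
Qed.

(** With [e = 1] the terms in [a] cancel in the determinant of the quotient matrix. *)
Lemma signless_laplacian_energy_multipartite (r1 r2 : algR) :
  r1 + r2 = (a + (3 * m - 2) * n)%:R -> r1 * r2 = (2 * m.-1 * m * n * n)%:R ->
  signless_laplacian_energy g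
  = algRval (a.-1%:R * `|dl0 - c| + (m * n.-1)%:R * `|dl1 - c|
     + m.-1%:R * `|dl1 - n%:R - c| + `|r1 - c| + `|r2 - c|).
Proof.
have m1E : m%:R = m.-1%:R + 1 :> algR by rewrite -{1}(prednK m_gt0) -natr1.
have m3E : (3 * m - 2)%:R = 3 * m%:R - 2 :> algR.
  by rewrite natrB ?natrM //; lia.
rewrite /signless_laplacian_energy average_degree_multipartite.
case: gP => I [p [i0 [S [adjE [i0S cardS] c0 cS pS]]]] r_sum r_prod.
rewrite (sum_spectrum_multipartite adjE i0S cardS c0 cS pS (d0 := dl0)
  (d1 := dl1) (e := 1) (r1 := r1) (r2 := r2)) // ?mul1r //.
- by rewrite r_sum /dl0 /dl1 !natrD !natrM m3E m1E; ring.
- by rewrite r_prod /dl0 /dl1 !natrD !natrM m1E; ring.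
rewrite /signless_laplacian_mx rmorph1 scale1r; congr (diag_mx _ + _).
apply/rowP=> j; rewrite !mxE.
rewrite (deg_multipartite adjE i0S cardS c0 cS pS _ m_gt0).
by case: ifP; rewrite rmorph_nat.
Qed.

End Energies.

(** * Reference values: the complete graph as a multipartite graph with singleton parts *)

Section CompleteGraph.
Local Open Scope ring_scope.
Variable m : nat.
Hypothesis m_gt0 : (0 < m)%N.

Lemma complete_graph_multipartite : complete_multipartite (complete_graph m.+1) 1 m 1.
Proof.
exists 'I_m.+1, id, ord0, [set~ ord0]; split=> //.
- by rewrite !inE eqxx cardsC1 card_ord.
- by rewrite (_ : [set x | x == ord0] = [set ord0]) ?cards1 //; apply/setP=> x; rewrite !inE.
- move=> i _; rewrite (_ : [set x | _] = [set i]) ?cards1 //.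
  by apply/setP=> x; rewrite !inE.
- by move=> x; rewrite !inE orbN.
Qed.

Let gP := complete_graph_multipartite.

Lemma multipartite_degree_complete : multipartite_degree 1 m 1 = m%:R.
Proof.
have m1E : m%:R = m.-1%:R + 1 :> algR by rewrite -{1}(prednK m_gt0) -natr1.
have m0 : (1 + m)%:R != 0 :> algR by rewrite pnatr_eq0.
rewrite /multipartite_degree !muln1; apply: canLR (mulfK m0) _.
by rewrite !natrM !natrD m1E; ring.
Qed.

Lemma energy_complete : energy (complete_graph m.+1) = algRval (2 * m%:R).
Proof.
have m1E : m%:R = m.-1%:R + 1 :> algR by rewrite -{1}(prednK m_gt0) -natr1.
rewrite (energy_multipartite gP _ _ _ (r1 := -1) (r2 := m%:R)) //.
- by rewrite normrN1 normr_nat !muln1 m1E; congr algRval; ring.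
- by rewrite !muln1 m1E; ring.
- by rewrite !muln1; ring.
Qed.

Lemma laplacian_energy_complete :
  laplacian_energy (complete_graph m.+1) = algRval (2 * m%:R).
Proof.
rewrite (laplacian_energy_multipartite gP) // multipartite_degree_complete.
rewrite !muln1 muln0 !mul0r !add0r natrD addrK normr1; congr algRval; ring.
Qed.

Lemma signless_laplacian_energy_complete :
  signless_laplacian_energy (complete_graph m.+1) = algRval (2 * m%:R).
Proof.
have m1E : m%:R = m.-1%:R + 1 :> algR by rewrite -{1}(prednK m_gt0) -natr1.
rewrite (signless_laplacian_energy_multipartite gP _ _ _
  (r1 := 2 * m%:R) (r2 := m.-1%:R)) // ?multipartite_degree_complete.
- rewrite !muln1 muln0 !mul0r !add0r natrD m1E.
  rewrite (_ : 1 + _ - 1 - _ = -1); last by ring.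
  rewrite (_ : 2 * _ - _ = m%:R); last by rewrite m1E; ring.
  rewrite (_ : m.-1%:R - _ = -1); last by ring.
  by rewrite normrN1 normr_nat m1E; congr algRval; ring.
- rewrite muln1 natrD natrB ?natrM; last by lia.
  by rewrite m1E; ring.
- by rewrite !natrM m1E; ring.
Qed.

End CompleteGraph.

(** * The non-commuting graph *)

Section AbelianIndex2.
Variables (gT : finGroupType) (G A : {group gT}).
Local Open Scope group_scope.
Local Notation Z := 'Z(G).
Hypotheses (nabG : ~~ abelian G) (abA : abelian A) (sAG : A \subset G).
Hypothesis indexA : #|G : A| = 2.

(** A subgroup of index 2 is maximal, by multiplicativity of the index. *)
Lemma index2_overgroup (H : {group gT}) x :
  A \subset H -> H \subset G -> x \in H :\: A -> G \subset H.
Proof.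
move=> sAH sHG /setDP[Hx A'x]; rewrite -indexg_eq1.
have H1 : #|H : A| > 1.
  by rewrite indexg_gt1; apply: contra A'x => /subsetP; apply.
have := Lagrange_index sHG sAH; rewrite indexA.
by case: #|_ : A| H1 => [|[|[|k]]] //; case: #|_ : _| => [|[|l]].
Qed.

(** The centralizer of [a] contains the abelian group [A] and also [x], hence is all of [G]. *)
Lemma commute_central a x : a \in A -> x \in G :\: A -> commute a x -> a \in Z.
Proof.
move=> Aa /setDP[Gx A'x] cax; rewrite inE (subsetP sAG) //=.
have sGC : G \subset 'C_G[a].
  apply: (@index2_overgroup _ x); rewrite ?subsetIl ?subsetI ?sAG //=.
    by rewrite sub_cent1 (subsetP abA).
  by rewrite in_setD A'x in_setI Gx; apply/cent1P.
by apply/centP=> y /(subsetP sGC)/setIP[_ /cent1P].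
Qed.

(** A central element outside [A] commutes with all of [A], which makes [A] central. The center then
    strictly contains [A], so it is [G], contrary to [nabG]. *)
Lemma center_sub_abelian_index2 : Z \subset A.
Proof.
apply/subsetP=> z Zz; have [Gz cz] := centerP _ _ Zz; apply: contraNT nabG => A'z.
suff sGZ : G \subset Z by apply: abelianS sGZ (center_abelian G).
apply: (@index2_overgroup _ z); rewrite ?subsetIl ?in_setD ?A'z //.
apply/subsetP=> a Aa; apply: (@commute_central a z); rewrite ?inE ?A'z //.
exact/commute_sym/cz/(subsetP sAG).
Qed.

Lemma setD_index2 x : x \in G :\: A -> G :\: A = x *: A.
Proof.
case/setDP=> Gx A'x; apply/esym/eqP; rewrite eqEcard card_lcoset cardsD.
rewrite (setIidPr sAG) -(Lagrange sAG) indexA muln2 -addnn addnK leqnn andbT.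
apply/subsetP=> _ /lcosetP[a Aa ->]; rewrite inE groupMr // A'x.
by rewrite groupM // (subsetP sAG).
Qed.

(** Outside [A] there is a single coset of [A], so [y^-1 * x] lies in [A]. If [x] and [y] commute,
    it commutes with [y], hence is central. *)
Lemma commute_setD x y : x \in G :\: A -> y \in G :\: A ->
  (x * y == y * x) = (x *: Z == y *: Z).
Proof.
move=> Ax Ay; rewrite [RHS]eq_sym; apply/eqP/eqP=> [cxy|/lcoset_eqP].
  apply/lcoset_eqP; rewrite mem_lcoset; apply: (@commute_central _ y) => //.
    by rewrite -mem_lcoset -setD_index2.
  by apply/commute_sym/commuteM => //; apply/commuteV/commute_sym.
case/lcosetP=> z Zz ->; have /setDP[Gx _] := Ax; have [_ cz] := centerP _ _ Zz.
by rewrite -!mulgA [z * x](cz x Gx).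
Qed.

Lemma noncommuting_multipartite (m : nat) : #|A| = (m * #|Z|)%N ->
  complete_multipartite (noncommuting_graph G) (m.-1 * #|Z|) m #|Z|.
Proof.
(* Parts are labelled by sets: [A] itself for the part [A :\: Z], and the coset of [Z] for an
   element outside [A]. No such coset equals [A], since it contains an element outside [A]. *)
move=> cardA; pose p (v : noncentral G) : {set gT} :=
  if val v \in A then A : {set gT} else val v *: Z.
have p_out v : val v \notin A -> p v = val v *: Z by rewrite /p => /negPf->.
have vG (v : noncentral G) : val v \in G by case/setDP: (valP v).
have card_val (B : {set gT}) : B \subset G :\: Z ->
    #|[set v : noncentral G | val v \in B]| = #|B|.
  move=> sB; rewrite -(card_imset _ val_inj); apply: eq_card => x.
  apply/imsetP/idP=> [[v]|Bx]; first by rewrite inE => ? ->.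
  by exists (Sub x (subsetP sB x Bx)); rewrite ?inE SubK.
have neqAx x : x \notin A -> A :!=: x *: Z.
  by apply: contraNneq => ->; rewrite lcoset_refl.
have neqxA x : x \notin A -> x *: Z :!=: A by rewrite eq_sym; apply: neqAx.
have sDZ x : x \in G :\: A -> x *: Z \subset G :\: A.
  by move=> Ax; rewrite (setD_index2 Ax) lcosetS ?center_sub_abelian_index2.
have sZA := center_sub_abelian_index2.
exists {set gT}, p, (A : {set gT}), [set x *: Z | x in G :\: A]; split.
- move=> v w /=; rewrite /noncommuting /= /p.
  case: ifPn => Av; case: ifPn => Aw.
  + by rewrite eqxx; apply/eqP; apply: (centsP abA).
  + apply: etrans (esym (neqAx _ Aw)); apply: contraL (valP v) => /eqP cvw; rewrite inE negb_and.
    by rewrite (@commute_central _ (val w)) // inE Aw vG.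
  + apply: etrans (esym (neqxA _ Av)); apply: contraL (valP w) => /eqP cvw.
    by rewrite inE negb_and (@commute_central _ (val v)) // inE Av vG.
  + by congr negb; apply: commute_setD; rewrite inE ?Av ?Aw vG.
- split.
    by apply/imsetP=> -[x /setDP[_ A'x] /eqP]; apply/negP/neqAx.
  have [x Ax] : exists x, x \in G :\: A.
    apply/set0Pn; rewrite setD_eq0; apply: contra nabG => sGA.
    exact: abelianS sGA abA.
  (* Translation by [x] carries the cosets of [Z] inside [A] to those outside, so there are
     [#|A : Z|] of them. *)
  have -> : [set y *: Z | y in G :\: A] = [set x *: B | B in lcosets Z A].
    apply/setP=> B; apply/imsetP/imsetP=> [[y]|[C /lcosetsP[a Aa ->] ->]].
      rewrite (setD_index2 Ax) => /lcosetP[a Aa ->] ->.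
      by exists (a *: Z); rewrite ?lcosetM //; apply/lcosetsP; exists a.
    by exists (x * a); rewrite ?lcosetM // (setD_index2 Ax) mem_lcoset mulKg.
  rewrite card_imset; last exact: lcoset_inj.
  rewrite card_lcosets; apply/eqP; rewrite -(eqn_pmul2l (cardG_gt0 Z)).
  by rewrite Lagrange // cardA mulnC.
- rewrite (_ : [set v | _] = [set v | val v \in A :\: Z]).
    by rewrite card_val ?setSD // cardsDS // cardA -subn1 mulnBl mul1n.
  apply/setP=> v; rewrite in_set [RHS]in_set in_setD /p; case: ifPn => Av.
    by rewrite eqxx andbT; case/setDP: (valP v) => _ ->.
  by rewrite andbF; apply: negbTE; apply: neqxA.
- move=> _ /imsetP[y Ay ->]; rewrite (_ : [set v | _] = [set v | val v \in y *: Z]).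
    by rewrite card_val ?card_lcoset // (subset_trans (sDZ y Ay)) ?setDS.
  apply/setP=> v; rewrite in_set [RHS]in_set; apply/eqP/idP => [|yv].
    rewrite /p; case: ifPn => [_ Ay'|_ <-]; last exact: lcoset_refl.
    by case/setDP: Ay => _ /neqAx; rewrite Ay' eqxx.
  have /setDP[_ A'v] := subsetP (sDZ y Ay) _ yv.
  by rewrite p_out //; apply/lcoset_eqP.
move=> v; apply/setU1P; rewrite /p; case: ifPn => Av; [by left | right].
by apply: imset_f; rewrite inE Av vG.
Qed.

End AbelianIndex2.

(** * From the dihedral quotient to an abelian subgroup of index 2 *)

Section DihedralQuotient.
Local Open Scope group_scope.

(** The presentation bounds the orders of the generators by [m] and 2. As [H] is the product of the
    two cyclic groups and has order [2 * m], the order of the rotation is exactly [m]. *)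
Lemma dihedral_cyclic_index2 (gT : finGroupType) (H : {group gT}) (m : nat) :
  (1 < m)%N -> H \isog 'D_(2 * m) ->
  exists2 x, x \in H & #[x] = m /\ #|H : <[x]>| = 2.
Proof.
move=> m_gt1; rewrite mul2n; case/(isoGrpP _ (Grp_dihedral m_gt1)).
rewrite card_dihedral // => oH /existsP[[x y]] /=.
case/eqP=> defH xm y2 xy.
have{} defH : <[x]> * <[y]> = H.
  by rewrite -norm_joinEr // norms_cycle xy groupV cycle_id.
have Hx : x \in H by rewrite -defH (subsetP (mulG_subl _ _)) ?cycle_id.
have sxH : <[x]> \subset H by rewrite cycle_subG.
have ox : #[x] = m.
  have x_le : #[x] <= m by rewrite dvdn_leq ?(ltnW m_gt1) // order_dvdn xm.
  have y_le : #[y] <= 2 by rewrite dvdn_leq // order_dvdn y2.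
  apply/eqP; rewrite eqn_leq x_le -(@leq_pmul2r 2) // muln2 -oH -defH.
  apply: leq_trans (leq_mul (leqnn _) y_le).
  by rewrite !orderE mul_cardG leq_pmulr ?cardG_gt0.
exists x; rewrite // -divgS //; split=> //.
by rewrite oH -orderE ox -muln2 mulKn // ltnW.
Qed.

Lemma dihedral_noncommuting_graph (gT : finGroupType) (G : {group gT}) (m : nat) :
  (1 < m)%N -> G / 'Z(G) \isog 'D_(2 * m) ->
  complete_multipartite (noncommuting_graph G) (m.-1 * #|'Z(G)|) m #|'Z(G)|.
Proof.
move=> m_gt1 isoG; have nZG := normal_norm (center_normal G).
have [xb Gx [ox ix]] := dihedral_cyclic_index2 m_gt1 isoG.
have sxG : <[xb]> \subset G / 'Z(G) by rewrite cycle_subG.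
have nabG : ~~ abelian G.
  apply: contraTN m_gt1 => abG; have := Lagrange sxG.
  rewrite -orderE ox ix card_quotient // (_ : #|G : 'Z(G)| = 1%N) => [|]; first lia.
  by apply/eqP; rewrite indexg_eq1 subsetI subxx.
have [A defA sZA sAG] := inv_quotientS (center_normal G) sxG.
(* [A] is cyclic modulo a central subgroup. *)
have cAA : abelian A.
  apply: (@cyclic_factor_abelian _ 'Z(G)); last by rewrite -defA cycle_cyclic.
  by rewrite subsetI sZA (subset_trans (subsetIr _ _)) ?centS.
have nZA : 'Z(G) <| A by apply: normalS (center_normal G).
apply: (noncommuting_multipartite nabG cAA sAG).
  rewrite -(index_quotient_eq (H := 'Z(G))) -?defA //.
  exact: subset_trans (subsetIr _ _) sZA.
rewrite -(Lagrange sZA) mulnC -card_quotient ?normal_norm // -defA.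
by rewrite -orderE ox.
Qed.

End DihedralQuotient.

(** * Comparison of the energies *)

Section Inequalities.
Local Open Scope ring_scope.
Variable R : rcfType.
Implicit Types u n : R.

(* u stands for m - 1 and n for |Z(G)|. *)
Definition sE u : R := Num.sqrt (u * (5 * u + 4)).
Definition sQ u : R := Num.sqrt (8 * u ^+ 2 + 1).
(** [coefK] collects the quadratic terms from the eigenvalues equal to vertex degrees, shared by
    both Laplacian energies. In [coefB] the absolute value comes from the signless eigenvalue of
    multiplicity [m - 1], and the subtracted term from the missing 1 in the multiplicities [a - 1]
    and [m * (n - 1)]. *)
Definition coefK u : R := 2 * u * (u + 1) * (u - 1) / (2 * u + 1).
Definition coefB u : R :=
  (u * `|u ^+ 2 - 3 * u - 1| - (u + 1) ^+ 2 * (u - 1)) / (2 * u + 1).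
Definition energy_val u n : R := n * (u + sE u).
Definition laplacian_val u n : R := n * (coefK u * n + 2 * (u + 1)).
Definition signless_val u n : R := n * (coefK u * n + coefB u + sQ u).

Lemma sqrtr_between (x y z : R) :
  0 <= x -> 0 <= z -> x ^+ 2 <= y <= z ^+ 2 -> x <= Num.sqrt y <= z.
Proof.
move=> x0 z0 /andP[xy yz]; rewrite -{1}(ger0_norm x0) -(ger0_norm z0).
by rewrite -!sqrtr_sqr !ler_wsqrtr.
Qed.

Lemma coefKB_2 : coefK 2 = 12 / 5 /\ coefB 2 = - (3 / 5).
Proof.
rewrite /coefK /coefB (_ : 2 ^+ 2 - 3 * 2 - 1 = - 3); last by ring.
by rewrite normrN normr_nat; split; field.
Qed.

Lemma coefKB_3 : coefK 3 = 48 / 7 /\ coefB 3 = - (29 / 7).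
Proof.
rewrite /coefK /coefB (_ : 3 ^+ 2 - 3 * 3 - 1 = - 1); last by ring.
by rewrite normrN1; split; field.
Qed.

(** Here the absolute value opens with a plus sign and [2 * u + 1] divides the numerator of [coefB].
    The bound on [coefK] drops the ratio [2 * (u + 1) / (2 * u + 1)], which exceeds 1. *)
Lemma coefKB_ge4 u : 4 <= u -> u * (u - 1) <= coefK u /\ coefB u = 1 - 2 * u.
Proof.
move=> u_ge4; have T_gt0 : 0 < 2 * u + 1 by lra.
rewrite /coefK /coefB ger0_norm; last by nra.
split; last by apply: canLR (mulfK (lt0r_neq0 T_gt0)) _; ring.
rewrite ler_pdivlMr //; nra.
Qed.

Lemma sE_bounds u : 2 <= u -> u + 1 <= sE u <= 3 * u.
Proof. by move=> u2; apply: sqrtr_between; [lra | lra | apply/andP; split; nra]. Qed.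

Lemma sQ_bounds u : 2 <= u -> 14 / 5 * u <= sQ u <= 3 * u.
Proof. by move=> u2; apply: sqrtr_between; [lra | lra | apply/andP; split; nra]. Qed.

(* The argument of the absolute value in coefB is negative for u = 2 and u = 3,
   and positive from u = 4 on. *)
Variant two_three_or_ge4 u : Prop :=
  | IsTwo of u = 2
  | IsThree of u = 3
  | GeFour of 4 <= u.

(** After division by [n], only the term [coefK u * n] still depends on [n]. It increases with [n],
    so the case [n = 1] decides. *)
Lemma energy_lt_signless u n :
  two_three_or_ge4 u -> 1 <= n -> energy_val u n < signless_val u n.
Proof.
move=> u_case n1; rewrite ltr_pM2l; last by lra.
case: u_case => [->|->|u4].
- have [-> ->] := coefKB_2; have /andP[sQl _] := sQ_bounds (lexx 2).
  (* The general bound [3 * u] is too weak here. At [n = 1] these constants compare 7.3 with 7.4. *)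
  have /andP[_ sEu] : 0 <= sE 2 <= 53 / 10 by apply: sqrtr_between; lra.
  lra.
- have [-> ->] := coefKB_3; have /andP[sQl _] := @sQ_bounds 3 ltac:(lra).
  have /andP[_ sEu] : 0 <= sE 3 <= 76 / 10 by apply: sqrtr_between; lra.
  lra.
have [K_ge ->] := coefKB_ge4 u4; have /andP[sQl _] := @sQ_bounds u ltac:(lra).
have /andP[_ sEu] : 0 <= sE u <= 5 / 2 * u.
  by apply: sqrtr_between; [lra | lra | apply/andP; split; nra].
have Kn_ge : coefK u <= coefK u * n by rewrite ler_peMr //; nra.
nra.
Qed.

(** The terms in [coefK] cancel, which leaves [coefB u + sQ u < 2 * (u + 1)]. *)
Lemma signless_lt_laplacian u n :
  two_three_or_ge4 u -> 1 <= n -> signless_val u n < laplacian_val u n.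
Proof.
move=> u_case n1; rewrite ltr_pM2l; last by lra.
rewrite -addrA ltrD2l.
case: u_case => [->|->|u4].
- by have [_ ->] := coefKB_2; have /andP[_ sQu] := sQ_bounds (lexx 2); lra.
- by have [_ ->] := coefKB_3; have /andP[_ sQu] := @sQ_bounds 3 ltac:(lra); lra.
by have [_ ->] := coefKB_ge4 u4; have /andP[_ sQu] := @sQ_bounds u ltac:(lra); lra.
Qed.

(** The graph has [(2 * u + 1) * n] vertices. The lower bound excludes hypoenergetic and the upper
    one, the energy of the complete graph, excludes hyperenergetic. *)
Lemma energy_between u n : 2 <= u -> 1 <= n ->
  (2 * u + 1) * n <= energy_val u n <= 2 * ((2 * u + 1) * n - 1).
Proof.
by move=> u2 n1; have /andP[] := sE_bounds u2; rewrite /energy_val; nra.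
Qed.

(** The exceptional graph on 5 vertices: the complete graph gives 8, and the bound on [sQ 2] gives
    at most 7.8. *)
Lemma signless_2_1 : signless_val 2 1 <= 2 * ((2 * 2 + 1) * 1 - 1).
Proof.
rewrite /signless_val; have [-> ->] := coefKB_2.
by have /andP[_ sQu] := sQ_bounds (lexx 2); lra.
Qed.

Lemma laplacian_2_1 : 2 * ((2 * 2 + 1) * 1 - 1) < laplacian_val 2 1.
Proof. by rewrite /laplacian_val; have [-> _] := coefKB_2; lra. Qed.

(** The left side is the value of the complete graph. The integer gap between [n = 1] and [2 <= n]
    is put into the hypothesis because [n] is a real number here. *)
Lemma signless_gt u n :
  (u = 2 \/ u = 3) /\ 2 <= n \/ 4 <= u /\ (n = 1 \/ 2 <= n) ->
  2 * ((2 * u + 1) * n - 1) < signless_val u n.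
Proof.
rewrite /signless_val; case=> [[[->|->] n2]|[u4 n_case]].
- have [-> ->] := coefKB_2.
  have /andP[sQl _] : 57 / 10 <= sQ 2 <= 6 by apply: sqrtr_between; lra.
  nra.
- have [-> ->] := coefKB_3; have /andP[sQl _] := @sQ_bounds 3 ltac:(lra).
  nra.
have [K_ge ->] := coefKB_ge4 u4; have /andP[sQl _] := @sQ_bounds u ltac:(lra).
(* For [n = 1] the estimate is tight: at [u = 4] it compares 16.2 with 16. *)
case: n_case => [->|n2]; first by nra.
have K_ge0 : 0 <= coefK u by nra.
have Kn_ge : coefK u * 2 <= coefK u * n by rewrite ler_wpM2l.
(* The cofactor of [n] already reaches [2 * (2 * u + 1)]; the constant [-2] of the target makes the
   inequality strict. *)
have : 0 <= coefK u * n + (1 - 2 * u) + sQ u - 2 * (2 * u + 1) by nra.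
nra.
Qed.

End Inequalities.

(** * Closed forms of the three energies when the large part has size [m.-1 * n] *)

Section DihedralEnergies.
Local Open Scope ring_scope.
Variables (g : sgraph) (m n : nat).
Hypotheses (gP : complete_multipartite g (m.-1 * n) m n).
Hypotheses (m_ge3 : (3 <= m)%N) (n_gt0 : (0 < n)%N).
Let u : algR := m.-1%:R.
Let x : algR := n%:R.
Let T : algR := 2 * u + 1.
Let c := multipartite_degree (m.-1 * n) m n.

Let m_gt0 : (0 < m)%N. Proof. by lia. Qed.
Let a_gt0 : (0 < m.-1 * n)%N. Proof. by rewrite muln_gt0 n_gt0; lia. Qed.
Let u_ge2 : 2 <= u. Proof. by rewrite ler_nat; lia. Qed.
Let x_ge1 : 1 <= x. Proof. by rewrite ler1n. Qed.
Let T_gt0 : 0 < T. Proof. by have := u_ge2; rewrite /T; lra. Qed.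
Let T_neq0 : T != 0. Proof. exact: lt0r_neq0. Qed.
Let mE : m%:R = u + 1 :> algR. Proof. by rewrite -{1}(prednK m_gt0) -natr1. Qed.
Let n1E : n.-1%:R = x - 1 :> algR. Proof. by rewrite -subn1 natrB. Qed.
Let a1E : (m.-1 * n).-1%:R = u * x - 1 :> algR.
Proof. by rewrite -subn1 natrB // natrM. Qed.

(** The quotient roots have opposite signs, so their absolute values add up to their difference
    [x * sE u]. *)
Lemma energy_dihedral : energy g = algRval (energy_val u x).
Proof.
have u2 := u_ge2; have x1 := x_ge1; have T0 := T_gt0.
have /andP[sE_ge _] := sE_bounds u_ge2.
have sE2 : sE u ^+ 2 = u * (5 * u + 4) by rewrite sqr_sqrtr //; nra.
rewrite (energy_multipartite gP a_gt0 m_gt0 n_gt0 (r1 := x / 2 * (u + sE u))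
  (r2 := x / 2 * (u - sE u))) //; first congr algRval.
- have r1_ge0 : 0 <= x / 2 * (u + sE u) by apply: mulr_ge0; lra.
  have r2_le0 : x / 2 * (u - sE u) <= 0 by apply: mulr_ge0_le0; lra.
  rewrite (ger0_norm r1_ge0) (ler0_norm r2_le0).
  by rewrite natrM /energy_val -/u -/x; field.
- by rewrite [RHS]natrM -/u -/x; field.
- rewrite !natrM mE -/u -/x.
  have -> : x / 2 * (u + sE u) * (x / 2 * (u - sE u)) = x ^+ 2 / 4 * (u ^+ 2 - sE u ^+ 2).
    by field.
  by rewrite sE2; field.
Qed.

Let cE : c = 3 * u * (u + 1) * x / T.
Proof.
have u2 := u_ge2; have x1 := x_ge1; have T0 := T_gt0.
have x_neq0 : x != 0 by lra.
rewrite /c /multipartite_degree !(natrM, natrD) mE -/u -/x /T; field.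
rewrite -/u -/x -/T T_neq0 (_ : u * x + (u + 1) * x = T * x) ?mulf_neq0 //.
by rewrite /T; ring.
Qed.

(** The average degree lies between the two vertex degrees; this form and that of [dl1E] make the
    signs visible. *)
Let dl0E : (m * n)%:R - c = - (x * ((u + 1) * (u - 1) / T)).
Proof. by rewrite cE natrM mE -/x /T; field; exact: T_neq0. Qed.

Let dl1E : (m.-1 * n + m.-1 * n)%:R - c = x * (u * (u - 1) / T).
Proof. by rewrite cE natrD natrM -/u -/x /T; field; exact: T_neq0. Qed.

Let q_ge0 t : 0 <= t -> 0 <= x * (t / T).
Proof.
have x1 := x_ge1; have T0 := T_gt0.
by move=> t_ge0; rewrite mulr_ge0 ?divr_ge0 //; lra.
Qed.

Lemma laplacian_energy_dihedral :
  laplacian_energy g = algRval (laplacian_val u x).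
Proof.
have u2 := u_ge2; have x1 := x_ge1; have T0 := T_gt0.
rewrite (laplacian_energy_multipartite gP) // -/c dl0E dl1E.
have -> : (m.-1 * n + m * n)%:R - c = x * ((u ^+ 2 + u + 1) / T).
  by rewrite cE !(natrD, natrM) mE -/u -/x /T; field; exact: T_neq0.
rewrite normrN !ger0_norm; try by apply: q_ge0; nra.
rewrite a1E natrM n1E mE cE /laplacian_val /coefK /T; congr algRval.
by field; exact: T_neq0.
Qed.

Lemma signless_laplacian_energy_dihedral :
  signless_laplacian_energy g = algRval (signless_val u x).
Proof.
have u2 := u_ge2; have x1 := x_ge1; have T0 := T_gt0.
have /andP[sQ_ge _] := sQ_bounds u_ge2.
have sQ2 : sQ u ^+ 2 = 8 * u ^+ 2 + 1 by rewrite sqr_sqrtr //; nra.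
rewrite (signless_laplacian_energy_multipartite gP a_gt0 m_gt0 n_gt0
  (r1 := x / 2 * (4 * u + 1 + sQ u)) (r2 := x / 2 * (4 * u + 1 - sQ u))) //.
- rewrite -/c dl0E dl1E.
  have -> : (m.-1 * n + m.-1 * n)%:R - n%:R - c = x * (u ^+ 2 - 3 * u - 1) / T.
    by rewrite cE natrD natrM -/u -/x /T; field; exact: T_neq0.
  have r1E : x / 2 * (4 * u + 1 + sQ u) - c
      = x / 2 * ((2 * u ^+ 2 + 1) / T + sQ u) by rewrite cE /T; field; exact: T_neq0.
  have r2E : x / 2 * (4 * u + 1 - sQ u) - c
      = - (x / 2 * (sQ u - (2 * u ^+ 2 + 1) / T)) by rewrite cE /T; field; exact: T_neq0.
  (* This places [c] between the two quotient roots, so their distances to [c] add up to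
     [x * sQ u]. *)
  have tT : 0 <= (2 * u ^+ 2 + 1) / T <= sQ u.
    apply/andP; split; first by rewrite divr_ge0 //; nra.
    by rewrite ler_pdivrMr // /T; nra.
  rewrite r1E r2E !normrN [X in _ + X + _]ger0_norm; last by nra.
  rewrite [X in _ + X]ger0_norm; last by nra.
  have wE : `|x * (u ^+ 2 - 3 * u - 1) / T| = x * (`|u ^+ 2 - 3 * u - 1| / T).
    by rewrite !normrM normfV (gtr0_norm T0) ger0_norm ?mulrA //; lra.
  rewrite wE [`|x * _|]ger0_norm; last by apply: q_ge0; nra.
  rewrite [`|x * _|]ger0_norm; last by apply: q_ge0; nra.
  rewrite a1E natrM n1E mE -/u /signless_val /coefK /coefB /T; congr algRval.
  by field; exact: T_neq0.
- by rewrite natrD !natrM natrB ?natrM ?mE -/u -/x; [field | lia].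
- rewrite !natrM mE -/u -/x.
  have -> : x / 2 * (4 * u + 1 + sQ u) * (x / 2 * (4 * u + 1 - sQ u))
      = x ^+ 2 / 4 * ((4 * u + 1) ^+ 2 - sQ u ^+ 2) by field.
  by rewrite sQ2; field.
Qed.

End DihedralEnergies.

Theorem theorem2p20 (gT : finGroupType) (G : {group gT}) (m : nat)
    (m_ge3 : 3 <= m) (isoG : ((G / 'Z(G)) \isog 'D_(2 * m))%g) :
  let Gamma := noncommuting_graph G in
  [/\ (* (a) *)
      (energy Gamma < signless_laplacian_energy Gamma)%R /\
      (signless_laplacian_energy Gamma < laplacian_energy Gamma)%R,
      (* (b) *)
      ~ hypoenergetic Gamma /\ ~ hyperenergetic Gamma
    & (* (c) *)
      (m = 3 /\ #|'Z(G)%g| = 1 ->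
         L_hyperenergetic Gamma /\ ~ Q_hyperenergetic Gamma) /\
      ((m = 3 \/ m = 4) /\ #|'Z(G)%g| <> 1 \/ 5 <= m /\ 1 <= #|'Z(G)%g| ->
         Q_hyperenergetic Gamma /\ L_hyperenergetic Gamma)].
Proof.
move=> Gamma; set n := #|'Z(G)%g|.
have gP : complete_multipartite Gamma (m.-1 * n) m n.
  by apply: dihedral_noncommuting_graph => //; apply: ltnW.
have n_gt0 : 0 < n by apply: cardG_gt0.
have ltE (a b : algR) : (algRval a < algRval b)%R = (a < b)%R by [].
pose u : algR := m.-1%:R%R; pose x : algR := n%:R%R.
have x1 : (1 <= x)%R by rewrite ler1n.
have u2 : (2 <= u)%R by rewrite ler_nat; lia.
have u_case : two_three_or_ge4 u.
  case: m m_ge3 @u u2 {isoG gP} => [|[|[|[|[|k]]]]] // _ u _.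
  - exact: IsTwo.
  - exact: IsThree.
  by apply: GeFour; rewrite ler_nat.
(* The vertex count is written as a successor because all three energies of the complete graph on
   [k.+1] vertices are [2 * k]. *)
have [k cardE kE] : exists2 k, #|Gamma| = k.+1 & k%:R%R = ((2 * u + 1) * x - 1)%R :> algR.
  exists (m.-1 * n + m * n).-1.
    by rewrite (card_complete_multipartite gP) prednK // addn_gt0 orbC muln_gt0 n_gt0; lia.
  rewrite -subn1 natrB; last by rewrite addn_gt0 orbC muln_gt0 n_gt0; lia.
  have mE : m%:R%R = (u + 1)%R :> algR by rewrite natr1 prednK //; lia.
  by rewrite natrD !natrM mE -/u -/x; ring.
have k_gt0 : 0 < k by rewrite -(ltr_nat algR) kE; nra.
rewrite /hypoenergetic /hyperenergetic /L_hyperenergetic /Q_hyperenergetic.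
rewrite cardE energy_complete // laplacian_energy_complete //.
rewrite signless_laplacian_energy_complete // kE -(rmorph_nat algRval).
rewrite (energy_dihedral gP) // (laplacian_energy_dihedral gP) //.
rewrite (signless_laplacian_energy_dihedral gP) // !ltE -/u -/x -natr1 kE subrK.
have E_lt_Q := energy_lt_signless u_case x1.
have Q_lt_L := signless_lt_laplacian u_case x1.
have /andP[E_ge E_le] := energy_between u2 x1.
split; [by [] | by split; apply/negP; rewrite -leNgt | split].
  case=> m3 n1; have -> : u = 2%:R%R by rewrite /u m3.
  have -> : x = 1%R by rewrite /x n1.
  by split; [apply: laplacian_2_1 | apply/negP; rewrite -leNgt; apply: signless_2_1].
(* Both complete-graph values coincide, so L-hyperenergetic follows from Q-hyperenergetic by part
   (a). *)
move=> H; suff Q_gt : (2 * ((2 * u + 1) * x - 1) < signless_val u x)%R.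
  by split=> //; apply: lt_trans Q_lt_L.
apply: signless_gt; case: H => [[m34 n1]|[m5 _]]; [left | right]; split.
- by case: m34 => mE; [left | right]; rewrite /u mE.
- by rewrite ler_nat; lia.
- by rewrite ler_nat; lia.
have [n1|] := leqP n 1; [left | right; last by rewrite ler_nat].
by rewrite /x (_ : n = 1) //; lia.
Qed.
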